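(* For a Lie--Rinehart algebra $(A,L)$ the following data are equivalent: (1) a BV operator (BV-differential) $\Delta$ on $\Lambda_A^\bullet L$ generating the Gerstenhaber bracket of $\Lambda_A^\bullet L$; (2) a divergence operator $\operatorname{div}:L\to A$, i.e. an additive map satisfying $\operatorname{div}[X,Y]=X(\operatorname{div}Y)-Y(\operatorname{div}X)$ and $\operatorname{div}(aX)=a\operatorname{div}X+X(a)$ for all $X,Y\in L$, $a\in A$.
   Context: A Lie--Rinehart algebra $(A,L)$ consists of a commutative algebra $A$ (over a field), a Lie algebra $L$ that is also an $A$-module, and a Lie algebra map (the anchor) $L\to\operatorname{Der}(A)$, written $X\mapsto (a\mapsto X(a))$, such that $[X,fY]=f[X,Y]+X(f)Y$ for $f\in A$, $X,Y\in L$. A Gerstenhaber algebra is a graded-commutative algebra with a bracket making its shift by one a super Lie algebra and satisfying $[a,bc]=[a,b]c+(-1)^{(|a|-1)|b|}b[a,c]$ for homogeneous elements. The exterior algebra $\Lambda_A^\bullet L$ is a Gerstenhaber algebra with the unique Gerstenhaber bracket that restricts to the Lie bracket on $L$ and satisfies $[X,f]=X(f)$ for $X\in L$, $f\in A$. A BV operator on a graded-commutative algebra is an operator $\Delta$ of degree $-1$ with $\Delta^2=0$ and $$\Delta(abc)-\Delta(ab)c+\Delta(a)bc-(-1)^{|a|}a\Delta(bc)-(-1)^{(|a|+1)|b|}b\Delta(ac)+(-1)^{|a|}a\Delta(b)c+(-1)^{|a|+|b|}ab\Delta(c)-\Delta(1)abc=0$$ for homogeneous $a,b,c$. It generates the Gerstenhaber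 bracket if $[a,b]=(-1)^{|a|}\Delta(ab)-(-1)^{|a|}\Delta(a)b-a\Delta(b)+a\Delta(1)b$ for all homogeneous $a,b$. *)

(* Defs.v *)
From HB Require Import structures.
From mathcomp Require Import all_boot all_order all_algebra.
From mathcomp Require Import boolp.

Set Implicit Arguments.
Unset Strict Implicit.
Unset Printing Implicit Defensive.

Import GRing.Theory.

Local Open Scope ring_scope.
Local Open Scope quotient_scope.

(* A vector space structure over [k] on the [A]-module [L] is not part of the
   data: it is the restriction of scalars [c, X |-> c%:A *: X].
   The anchor is not assumed to be A-linear: this is forced as soon as the
   exterior algebra has a Gerstenhaber bracket with [X, f] = X(f), because
   then (fX)(g) = [fX, g] = f [X, g] by the Leibniz rule. *)
Record lieRinehart (k : fieldType) (A : comAlgType k) (L : lmodType A) :=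
  LieRinehart {
  lieb : L -> L -> L;
  anchor : L -> A -> A;
  lieb_linearl : forall (c : k) (X Y Z : L),
    lieb (c%:A *: X + Y) Z = c%:A *: lieb X Z + lieb Y Z;
  lieb_linearr : forall (c : k) (X Y Z : L),
    lieb X (c%:A *: Y + Z) = c%:A *: lieb X Y + lieb X Z;
  liebxx : forall X : L, lieb X X = 0;
  lieb_jacobi : forall X Y Z : L,
    lieb X (lieb Y Z) + lieb Y (lieb Z X) + lieb Z (lieb X Y) = 0;
  anchor_der_linear : forall (X : L) (c : k) (f g : A),
    anchor X (c *: f + g) = c *: anchor X f + anchor X g;
  anchor_der_leibniz : forall (X : L) (f g : A),
    anchor X (f * g) = anchor X f * g + f * anchor X g;
  anchor_linear : forall (c : k) (X Y : L) (f : A),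
    anchor (c%:A *: X + Y) f = c *: anchor X f + anchor Y f;
  anchor_lieb : forall (X Y : L) (f : A),
    anchor (lieb X Y) f = anchor X (anchor Y f) - anchor Y (anchor X f);
  lieb_leibniz : forall (X Y : L) (f : A),
    lieb X (f *: Y) = f *: lieb X Y + anchor X f *: Y
}.

(* The exterior algebra of [L] over [A] is the unital associative [A]-algebra
   presented by generators [ExtGen x], [x : L], subject to [A]-linearity in [x]
   and to [ExtGen x * ExtGen x = 0]; [ExtSc] is the structure map from [A].
   See [ext_universal] for its universal property. *)

Inductive ext_term (A L : Type) : Type :=
| ExtSc of A
| ExtGen of L
| ExtAdd of ext_term A L & ext_term A L
| ExtMul of ext_term A L & ext_term A L.

Arguments ExtSc {A L}.
Arguments ExtGen {A L}.

HB.instance Definition _ (A L : Type) := gen_eqMixin (ext_term A L).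
HB.instance Definition _ (A L : Type) := gen_choiceMixin (ext_term A L).

Section ExteriorAlgebra.
Variables (A : comNzRingType) (L : lmodType A).

Local Notation term := (ext_term A L).

Inductive ext_cong : term -> term -> Prop :=
| ExtRefl s : ext_cong s s
| ExtSym s t : ext_cong s t -> ext_cong t s
| ExtTrans s t u : ext_cong s t -> ext_cong t u -> ext_cong s u
| ExtAddCong s s' t t' : ext_cong s s' -> ext_cong t t' ->
    ext_cong (ExtAdd s t) (ExtAdd s' t')
| ExtMulCong s s' t t' : ext_cong s s' -> ext_cong t t' ->
    ext_cong (ExtMul s t) (ExtMul s' t')
| ExtAddA s t u : ext_cong (ExtAdd s (ExtAdd t u)) (ExtAdd (ExtAdd s t) u)
| ExtAddC s t : ext_cong (ExtAdd s t) (ExtAdd t s)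
| ExtAdd0 t : ext_cong (ExtAdd (ExtSc 0) t) t
| ExtMulA s t u : ext_cong (ExtMul s (ExtMul t u)) (ExtMul (ExtMul s t) u)
| ExtMul0 t : ext_cong (ExtMul (ExtSc 0) t) (ExtSc 0)
| ExtMul1 t : ext_cong (ExtMul (ExtSc 1) t) t
| ExtMulDl s t u :
    ext_cong (ExtMul (ExtAdd s t) u) (ExtAdd (ExtMul s u) (ExtMul t u))
| ExtMulDr s t u :
    ext_cong (ExtMul s (ExtAdd t u)) (ExtAdd (ExtMul s t) (ExtMul s u))
| ExtScD a b : ext_cong (ExtSc (a + b)) (ExtAdd (ExtSc a) (ExtSc b))
| ExtScM a b : ext_cong (ExtSc (a * b)) (ExtMul (ExtSc a) (ExtSc b))
| ExtScC a t : ext_cong (ExtMul (ExtSc a) t) (ExtMul t (ExtSc a))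
| ExtGenP a x y :
    ext_cong (ExtGen (a *: x + y)) (ExtAdd (ExtMul (ExtSc a) (ExtGen x)) (ExtGen y))
| ExtGenSq x : ext_cong (ExtMul (ExtGen x) (ExtGen x)) (ExtSc 0).

Definition ext_rel : rel term := fun s t => `[< ext_cong s t >].

Fact ext_rel_refl : reflexive ext_rel.
Proof. by move=> s; apply/asboolP; exact: ExtRefl. Qed.

Fact ext_rel_sym : symmetric ext_rel.
Proof. by move=> s t; apply/asboolP/asboolP => /ExtSym. Qed.

Fact ext_rel_trans : transitive ext_rel.
Proof.
by move=> t s u /asboolP st /asboolP tu; apply/asboolP; exact: ExtTrans st tu.
Qed.

Canonical ext_equiv := EquivRel ext_rel ext_rel_refl ext_rel_sym ext_rel_trans.

Definition extalg : Type := {eq_quot ext_equiv}.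

HB.instance Definition _ := Choice.on extalg.
HB.instance Definition _ := Quotient.on extalg.
HB.instance Definition _ := EqQuotient.on extalg.

Let cls (t : term) : extalg := \pi_extalg t.

Lemma ext_clsP s t : ext_cong s t <-> cls s = cls t.
Proof.
split=> [st|]; first by apply/eqmodP/asboolP.
by move/eqmodP/asboolP.
Qed.

Lemma ext_reprK (u : extalg) : cls (repr u) = u.
Proof. exact: reprK. Qed.

Lemma ext_repr t : ext_cong (repr (cls t)) t.
Proof. by apply/ext_clsP; rewrite ext_reprK. Qed.

Definition ext_sc (a : A) : extalg := cls (ExtSc a).
Definition ext_in (x : L) : extalg := cls (ExtGen x).
Definition ext_add (u v : extalg) : extalg := cls (ExtAdd (repr u) (repr v)).
Definition ext_mul (u v : extalg) : extalg := cls (ExtMul (repr u) (repr v)).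
Definition ext_opp (u : extalg) : extalg := ext_mul (ext_sc (- 1)) u.
Definition ext_scale (a : A) (u : extalg) : extalg := ext_mul (ext_sc a) u.

Fact ext_addE s t : ext_add (cls s) (cls t) = cls (ExtAdd s t).
Proof. by apply/ext_clsP; apply: ExtAddCong; exact: ext_repr. Qed.

Fact ext_mulE s t : ext_mul (cls s) (cls t) = cls (ExtMul s t).
Proof. by apply/ext_clsP; apply: ExtMulCong; exact: ext_repr. Qed.

Fact ext_quotW (P : extalg -> Prop) : (forall t, P (cls t)) -> forall u, P u.
Proof. by move=> Pcls u; rewrite -(ext_reprK u). Qed.

Fact ext_addA : associative ext_add.
Proof.
elim/ext_quotW=> s; elim/ext_quotW=> t; elim/ext_quotW=> u.
by rewrite !ext_addE; apply/ext_clsP; exact: ExtAddA.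
Qed.

Fact ext_addC : commutative ext_add.
Proof.
elim/ext_quotW=> s; elim/ext_quotW=> t.
by rewrite !ext_addE; apply/ext_clsP; exact: ExtAddC.
Qed.

Fact ext_add0 : left_id (ext_sc 0) ext_add.
Proof. by elim/ext_quotW=> s; rewrite ext_addE; apply/ext_clsP; exact: ExtAdd0. Qed.

Fact ext_mulA : associative ext_mul.
Proof.
elim/ext_quotW=> s; elim/ext_quotW=> t; elim/ext_quotW=> u.
by rewrite !ext_mulE; apply/ext_clsP; exact: ExtMulA.
Qed.

Fact ext_mul1l : left_id (ext_sc 1) ext_mul.
Proof. by elim/ext_quotW=> s; rewrite ext_mulE; apply/ext_clsP; exact: ExtMul1. Qed.

Fact ext_scC a u : ext_mul (ext_sc a) u = ext_mul u (ext_sc a).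
Proof.
by elim/ext_quotW: u => s; rewrite !ext_mulE; apply/ext_clsP; exact: ExtScC.
Qed.

Fact ext_mul1r : right_id (ext_sc 1) ext_mul.
Proof. by move=> u; rewrite -ext_scC ext_mul1l. Qed.

Fact ext_mulDl : left_distributive ext_mul ext_add.
Proof.
elim/ext_quotW=> s; elim/ext_quotW=> t; elim/ext_quotW=> u.
by rewrite !(ext_mulE, ext_addE); apply/ext_clsP; exact: ExtMulDl.
Qed.

Fact ext_mulDr : right_distributive ext_mul ext_add.
Proof.
elim/ext_quotW=> s; elim/ext_quotW=> t; elim/ext_quotW=> u.
by rewrite !(ext_mulE, ext_addE); apply/ext_clsP; exact: ExtMulDr.
Qed.

Fact ext_mul0 u : ext_mul (ext_sc 0) u = ext_sc 0.
Proof. by elim/ext_quotW: u => s; rewrite ext_mulE; apply/ext_clsP; exact: ExtMul0. Qed.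

Fact ext_scD a b : ext_sc (a + b) = ext_add (ext_sc a) (ext_sc b).
Proof. by rewrite ext_addE; apply/ext_clsP; exact: ExtScD. Qed.

Fact ext_scM a b : ext_sc (a * b) = ext_mul (ext_sc a) (ext_sc b).
Proof. by rewrite ext_mulE; apply/ext_clsP; exact: ExtScM. Qed.

Fact ext_addN : left_inverse (ext_sc 0) ext_opp ext_add.
Proof.
move=> u; rewrite /ext_opp -{2}(ext_mul1l u) -ext_mulDl -ext_scD.
by rewrite addNr ext_mul0.
Qed.

HB.instance Definition _ :=
  GRing.isZmodule.Build extalg ext_addA ext_addC ext_add0 ext_addN.

Fixpoint ext_eval (B : algType A) (f : L -> B) (t : term) : B :=
  match t with
  | ExtSc a => a%:A
  | ExtGen x => f x
  | ExtAdd s t => ext_eval f s + ext_eval f t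
  | ExtMul s t => ext_eval f s * ext_eval f t
  end.

Lemma ext_eval_cong (B : algType A) (f : {linear L -> B}) :
  (forall x, f x * f x = 0) ->
  forall s t, ext_cong s t -> ext_eval f s = ext_eval f t.
Proof.
move=> f2 s t; elim=> //= {s t}.
- by move=> s t u _ -> _ ->.
- by move=> s s' t t' _ -> _ ->.
- by move=> s s' t t' _ -> _ ->.
- by move=> s t u; rewrite addrA.
- by move=> s t; rewrite addrC.
- by move=> t; rewrite scale0r add0r.
- by move=> s t u; rewrite mulrA.
- by move=> t; rewrite scale0r mul0r.
- by move=> t; rewrite scale1r mul1r.
- by move=> s t u; rewrite mulrDl.
- by move=> s t u; rewrite mulrDr.
- by move=> a b; rewrite scalerDl.
- by move=> a b; rewrite mulr_algl scalerA.
- by move=> a t; rewrite mulr_algl mulr_algr.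
- by move=> a x y; rewrite linearP mulr_algl.
- by move=> x; rewrite f2 scale0r.
Qed.

(* The augmentation [extalg -> A] killing [L] shows that [1 != 0]. *)
Fact ext_oner_neq0 : ext_sc 1 != 0 :> extalg.
Proof.
apply/eqP => /ext_clsP.
have z2 : forall x, (\0 : {linear L -> A^o}) x * (\0 : {linear L -> A^o}) x = 0.
  by move=> x; rewrite mul0r.
by move/(ext_eval_cong z2) => /= /eqP; rewrite scale1r scale0r oner_eq0.
Qed.

HB.instance Definition _ := GRing.Zmodule_isNzRing.Build extalg
  ext_mulA ext_mul1l ext_mul1r ext_mulDl ext_mulDr ext_oner_neq0.

Fact ext_scaleA a b u : ext_scale a (ext_scale b u) = ext_scale (a * b) u.
Proof. by rewrite /ext_scale ext_mulA ext_scM. Qed.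

Fact ext_scale1 : left_id 1 ext_scale.
Proof. exact: ext_mul1l. Qed.

Fact ext_scaleDr : right_distributive ext_scale +%R.
Proof. by move=> a u v; exact: ext_mulDr. Qed.

Fact ext_scaleDl u : {morph ext_scale^~ u : a b / a + b}.
Proof. by move=> a b; rewrite /ext_scale ext_scD ext_mulDl. Qed.

HB.instance Definition _ := GRing.Zmodule_isLmodule.Build A extalg
  ext_scaleA ext_scale1 ext_scaleDr ext_scaleDl.

Fact ext_scaleAl a (u v : extalg) : a *: (u * v) = (a *: u) * v.
Proof. exact: ext_mulA. Qed.

HB.instance Definition _ := GRing.Lmodule_isLalgebra.Build A extalg ext_scaleAl.

Fact ext_scaleAr a (u v : extalg) : a *: (u * v) = u * (a *: v).
Proof.
change (ext_mul (ext_sc a) (ext_mul u v) = ext_mul u (ext_mul (ext_sc a) v)).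
by rewrite !ext_mulA ext_scC.
Qed.

HB.instance Definition _ := GRing.Lalgebra_isAlgebra.Build A extalg ext_scaleAr.

Lemma ext_scE a : ext_sc a = a%:A.
Proof. by rewrite -[LHS]ext_mul1r. Qed.

Fact ext_in_linear : linear ext_in.
Proof.
move=> a x y; change (ext_in (a *: x + y)
  = ext_add (ext_mul (ext_sc a) (ext_in x)) (ext_in y)).
by rewrite ext_mulE ext_addE; apply/ext_clsP; exact: ExtGenP.
Qed.

HB.instance Definition _ := GRing.isLinear.Build A L extalg *:%R ext_in ext_in_linear.

Lemma ext_in_sq x : ext_in x * ext_in x = 0.
Proof.
change (ext_mul (ext_in x) (ext_in x) = ext_sc 0).
by rewrite ext_mulE; apply/ext_clsP; exact: ExtGenSq.
Qed.

Lemma ext_ind (P : extalg -> Prop) :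
  (forall a : A, P a%:A) -> (forall x, P (ext_in x)) ->
  (forall u v, P u -> P v -> P (u + v)) ->
  (forall u v, P u -> P v -> P (u * v)) ->
  forall u, P u.
Proof.
move=> Psc Pin Padd Pmul; elim/ext_quotW; elim=> [a|x|s Ps t Pt|s Ps t Pt].
- by rewrite -/(ext_sc a) ext_scE.
- exact: Pin.
- by rewrite -ext_addE; exact: Padd.
- by rewrite -ext_mulE; exact: Pmul.
Qed.

Lemma ext_universal (B : algType A) (f : {linear L -> B}) :
  (forall x, f x * f x = 0) ->
  exists g : {lrmorphism extalg -> B}, forall x, g (ext_in x) = f x.
Proof.
move=> f2; pose g (u : extalg) : B := ext_eval f (repr u).
have gE t : g (cls t) = ext_eval f t by exact/ext_eval_cong/ext_repr.
have gsc a : g a%:A = a%:A by rewrite -ext_scE gE.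
have gD : {morph g : u v / u + v}.
  by elim/ext_quotW=> s; elim/ext_quotW=> t; rewrite [_ + _]ext_addE !gE.
have gM : {morph g : u v / u * v}.
  by elim/ext_quotW=> s; elim/ext_quotW=> t; rewrite [_ * _]ext_mulE !gE.
have gL : linear g by move=> a u v; rewrite gD -mulr_algl gM gsc mulr_algl.
have g1 : g 1 = 1 by rewrite -(scale1r 1) gsc scale1r.
pose mL := GRing.isLinear.Build A extalg B *:%R g gL.
pose mM := GRing.isMonoidMorphism.Build extalg B g (g1, gM).
pose G : {lrmorphism extalg -> B} := HB.pack g mL mM.
by exists G => x; apply: gE.
Qed.

Lemma ext_universal_uniq (B : algType A) (g h : {lrmorphism extalg -> B}) :
  (forall x, g (ext_in x) = h (ext_in x)) -> g =1 h.
Proof.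
move=> gh; elim/ext_ind=> [a|x|u v gu gv|u v gu gv] //.
- by rewrite !linearZ /= !rmorph1.
- by rewrite !raddfD /= gu gv.
- by rewrite !rmorphM /= gu gv.
Qed.

(* The [n]-th exterior power: the [A]-span of the products of [n] elements
   of [L]. *)
Definition ext_deg (n : nat) (u : extalg) : Prop :=
  exists s : seq (A * n.-tuple L),
    u = \sum_(p <- s) p.1 *: \prod_(x <- p.2) ext_in x.

Lemma ext_in_anticomm x y : ext_in x * ext_in y = - (ext_in y * ext_in x).
Proof.
apply/eqP; rewrite -addr_eq0; apply/eqP.
by have := ext_in_sq (x + y); rewrite raddfD mulrDl !mulrDr !ext_in_sq add0r addr0.
Qed.

Lemma ext_prod_comm (s t : seq L) :
  (\prod_(x <- s) ext_in x) * (\prod_(y <- t) ext_in y) =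
  (-1) ^+ (size s * size t) *
    ((\prod_(y <- t) ext_in y) * (\prod_(x <- s) ext_in x)).
Proof.
have xt x : ext_in x * (\prod_(y <- t) ext_in y)
    = (-1) ^+ size t * ((\prod_(y <- t) ext_in y) * ext_in x).
  elim: t => [|y t IHt] /=; first by rewrite big_nil !mul1r mulr1.
  rewrite big_cons mulrA ext_in_anticomm mulNr -(mulrA _ (ext_in x)) IHt.
  by rewrite exprS mulN1r mulNr !mulrA commr_sign.
elim: s => [|x s IHs] /=; first by rewrite big_nil !mul1r mulr1.
rewrite big_cons -mulrA IHs (mulrA (ext_in x)) commr_sign -(mulrA _ (ext_in x)).
by rewrite (mulrA (ext_in x)) xt mulSn addnC exprD !mulrA.
Qed.

Lemma ext_deg_comm m n u v :
  ext_deg m u -> ext_deg n v -> u * v = (-1) ^+ (m * n) * (v * u).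
Proof.
move=> [s ->] [t ->]; rewrite !big_distrlr /= exchange_big /= mulr_sumr.
apply: eq_bigr => q _; rewrite mulr_sumr; apply: eq_bigr => p _.
rewrite -!(scalerAl, scalerAr) !scalerA mulrC ext_prod_comm !size_tuple.
by rewrite scalerAr.
Qed.

End ExteriorAlgebra.

Section GerstenhaberBV.
Variables (k : fieldType) (A : comAlgType k) (E : algType A).
Variable deg : nat -> E -> Prop. (* [deg n u]: [u] is homogeneous of degree [n] *)

(* Homogeneous of degree [n - 1], the component of degree [-1] being zero. *)
Definition deg_pred (n : nat) (u : E) : Prop :=
  if n is m.+1 then deg m u else u = 0.

Definition klinear (f : E -> E) : Prop :=
  forall (c : k) (u v : E), f (c%:A *: u + v) = c%:A *: f u + f v.

(* The signs [(-1) ^ ((m - 1) * n)] are written with [m.+1] in place of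
   [m - 1], which has the same parity. *)
Record gerstenhaber_bracket (br : E -> E -> E) : Prop := {
  gerst_linearl : forall v, klinear (br^~ v);
  gerst_linearr : forall u, klinear (br u);
  gerst_deg : forall m n u v, deg m u -> deg n v -> deg_pred (m + n) (br u v);
  gerst_antisym : forall m n u v, deg m u -> deg n v ->
    br u v = - ((-1) ^+ (m.+1 * n.+1) * br v u);
  gerst_jacobi : forall l m n u v w, deg l u -> deg m v -> deg n w ->
    br u (br v w) = br (br u v) w + (-1) ^+ (l.+1 * m.+1) * br v (br u w);
  gerst_leibniz : forall l m n u v w, deg l u -> deg m v -> deg n w ->
    br u (v * w) = br u v * w + (-1) ^+ (l.+1 * m) * v * br u w
}.

Record BV_operator (D : E -> E) : Prop := {
  BV_linear : klinear D;
  BV_deg : forall n u, deg n u -> deg_pred n (D u);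
  BV_sq : forall u, D (D u) = 0;
  BV_seven_term : forall l m n a b c, deg l a -> deg m b -> deg n c ->
    D (a * b * c) - D (a * b) * c + D a * b * c
    - (-1) ^+ l * a * D (b * c) - (-1) ^+ (l.+1 * m) * b * D (a * c)
    + (-1) ^+ l * a * D b * c + (-1) ^+ (l + m) * a * b * D c
    - D 1 * a * b * c = 0
}.

Definition generates (D : E -> E) (br : E -> E -> E) : Prop :=
  forall m n a b, deg m a -> deg n b ->
    br a b = (-1) ^+ m * D (a * b) - (-1) ^+ m * D a * b - a * D b + a * D 1 * b.

End GerstenhaberBV.

Section LieRinehartData.
Variables (k : fieldType) (A : comAlgType k) (L : lmodType A).
Variable R : lieRinehart L.

Definition is_ext_gerstenhaber_bracket
    (br : extalg L -> extalg L -> extalg L) : Prop :=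
  [/\ gerstenhaber_bracket (@ext_deg A L) br,
      forall X Y : L, br (ext_in X) (ext_in Y) = ext_in (lieb R X Y)
    & forall (X : L) (f : A), br (ext_in X) f%:A = (anchor R X f)%:A].

Definition BV_generator (br : extalg L -> extalg L -> extalg L) : Type :=
  {D : extalg L -> extalg L |
    BV_operator (@ext_deg A L) D /\ generates (@ext_deg A L) D br}.

Definition divergence_operator : Type :=
  {div : L -> A |
    [/\ forall X Y, div (X + Y) = div X + div Y,
        forall X Y, div (lieb R X Y) = anchor R X (div Y) - anchor R Y (div X)
      & forall a X, div (a *: X) = a * div X + anchor R X a]}.

End LieRinehartData.

(* Main.v *)
Require Import Defs.
From mathcomp Require Import all_boot all_order all_algebra.
From HB Require Import structures.
From mathcomp Require Import boolp.

(* Write eps for the sign involution u |-> (-1)^|u| u of the exterior algebra E.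
   A generator D of the bracket satisfies
     D(uv) = [eps u, v] + D(u) v + eps(u) D(v),
   that is, u |-> (u, D u) is multiplicative for the product
     (u, u') (v, v') = (uv, [eps u, v] + u' v + eps(u) v')  on E * E.
   The Poisson identities make this an associative A-algebra, in which
   a in A acts as (a, 0); the rule div(aX) = a div X + X(a) says that
   X |-> (X, - div X) is A-linear, and it squares to zero, so it extends to E.
   The second component of the extension is D.  The defect
     D[u, v] - [Du, v] + [eps u, Dv]
   is, by the Jacobi identity, a derivation in v; it vanishes on generators
   exactly because div[X, Y] = X(div Y) - Y(div X), and D^2 is a derivation up
   to this defect, whence D^2 = 0.  Conversely, applying D to
   D(XY) = - [X, Y] + D(X) Y - X D(Y) gives the rule for div[X, Y]. *)

Import GRing.Theory.
Local Open Scope ring_scope.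

Set Implicit Arguments.
Unset Strict Implicit.
Unset Printing Implicit Defensive.

Lemma signE (R : pzRingType) n : (-1) ^+ n = (if odd n then -1 else 1) :> R.
Proof. by rewrite -signr_odd; case: odd. Qed.

(* Closes an equation between sums of signed atoms in an abelian group. *)
Ltac cancel :=
  apply/eqP; rewrite -subr_eq0; apply/eqP; rewrite ?(opprD, opprK, addrA, subr0);
  repeat match goal with
  | |- ?s + - ?z + ?z = 0 => rewrite (addrNK z s)
  | |- ?s + ?z - ?z = 0 => rewrite (addrK z s)
  | |- - ?z + ?z = 0 => exact: addNr
  | |- ?z - ?z = 0 => exact: subrr
  | |- 0 = 0 => done
  | |- _ - ?z = 0 => rewrite (addrAC _ z)
  | |- _ + ?z = 0 => rewrite (addrAC _ (- z))
  | |- _ + ?z = 0 => rewrite (addrC (- z))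
  | |- _ - ?z = 0 => rewrite (addrC z)
  end.

(** Powers of -1 become conditionals on the parities of the degrees, so a case split on [odd] leaves
    explicit signs. *)
Ltac signs := rewrite ?(signE, oddD, oddM) /= ?(oddD, oddM) /=.

Ltac expand :=
  rewrite /= ?(mul1r, mulN1r, mulr1, mulrN1, mul0r, mulr0, mulNr, mulrN, opprK,
    opprD, opprB, mulrDl, mulrDr, mulrBl, mulrBr, mulrA, addrA, addr0, add0r,
    oppr0, subr0).

(** * Degrees and the sign involution of the exterior algebra *)

Section ExteriorDegree.
Variables (A : comNzRingType) (L : lmodType A).
Local Notation E := (extalg L).
Local Notation "\i x" := (@ext_in A L x) (at level 10, x at level 9).
Implicit Types (u v w : E) (x y : L) (a b : A).

(** The augmentation extending the zero map of [L] is a retraction of the structure map. *)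
Lemma ext_sc_inj : injective (fun a => a%:A : E).
Proof.
have z2 x : (\0 : {linear L -> A^o}) x * (\0 : {linear L -> A^o}) x = 0.
  by rewrite mul0r.
have [g _] := ext_universal z2.
move=> a b /(congr1 g); rewrite !linearZ /= !rmorph1.
by rewrite ![_ *: 1]mulr1.
Qed.

Lemma ext_deg0 n : ext_deg n (0 : E).
Proof. by exists [::]; rewrite big_nil. Qed.

Lemma ext_degD n u v : ext_deg n u -> ext_deg n v -> ext_deg n (u + v).
Proof. by move=> [s ->] [t ->]; exists (s ++ t); rewrite big_cat. Qed.

Lemma ext_degZ n a u : ext_deg n u -> ext_deg n (a *: u).
Proof.
move=> [s ->]; exists [seq (a * p.1, p.2) | p <- s].
by rewrite big_map scaler_sumr; apply: eq_bigr => p _; rewrite scalerA.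
Qed.

Lemma ext_deg_sum n (I : Type) (r : seq I) (F : I -> E) :
  (forall i, ext_deg n (F i)) -> ext_deg n (\sum_(i <- r) F i).
Proof.
move=> degF; elim/big_ind: _ => // [|u v]; first exact: ext_deg0.
exact: ext_degD.
Qed.

Lemma ext_deg_prod (s : seq L) : ext_deg (size s) (\prod_(x <- s) \i x).
Proof.
by exists [:: (1, in_tuple s)]; rewrite big_cons big_nil scale1r addr0.
Qed.

Lemma ext_degM m n u v : ext_deg m u -> ext_deg n v -> ext_deg (m + n) (u * v).
Proof.
move=> [s ->] [t ->]; rewrite big_distrlr /=.
apply: ext_deg_sum => p; apply: ext_deg_sum => q.
rewrite -scalerAl -scalerAr; do 2!apply: ext_degZ.
by have := ext_deg_prod (p.2 ++ q.2); rewrite size_cat !size_tuple big_cat.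
Qed.

Lemma ext_deg1 : ext_deg 0 (1 : E).
Proof. by have := ext_deg_prod [::]; rewrite big_nil. Qed.

Lemma ext_deg_in x : ext_deg 1 (\i x).
Proof. by have := ext_deg_prod [:: x]; rewrite big_seq1. Qed.

Lemma ext_deg_sc a : ext_deg 0 (a%:A : E).
Proof. exact/ext_degZ/ext_deg1. Qed.

Lemma ext_deg0E u : ext_deg 0 u -> exists a, u = a%:A.
Proof.
move=> [s ->]; exists (\sum_(p <- s) p.1); rewrite scaler_suml.
by apply: eq_bigr => p _; rewrite tuple0 big_nil.
Qed.

(** [P] takes the degree as an argument because 0 is homogeneous of every degree. The steps rebuild
    a sum of scaled products, adding generators on the left. *)
Lemma ext_deg_ind (P : nat -> E -> Prop) :
    (forall n, P n 0) ->
    (forall n u v, P n u -> P n v -> P n (u + v)) ->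
    (forall n a u, ext_deg n u -> P n u -> P n (a *: u)) ->
    P 0 1 ->
    (forall n x u, ext_deg n u -> P n u -> P n.+1 (\i x * u)) ->
  forall n u, ext_deg n u -> P n u.
Proof.
move=> P0 PD PZ P1 PM n u [s ->].
elim/big_ind: _ => //= [v w|p _]; first exact: PD.
have Pprod (t : seq L) : P (size t) (\prod_(x <- t) \i x).
  elim: t => [|x t IH]; first by rewrite big_nil.
  by rewrite big_cons; apply: PM IH; apply: ext_deg_prod.
have dp := ext_deg_prod p.2; have := Pprod p.2.
by rewrite size_tuple in dp *; apply: PZ.
Qed.

(** Finite sums of homogeneous elements contain scalars and generators and are closed under sums and
    products, so they exhaust the algebra. Additive identities thereby reduce to homogeneous
    arguments. *)
Lemma ext_hom_ind (P : E -> Prop) :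
    (forall u v, P u -> P v -> P (u + v)) ->
    (forall n u, ext_deg n u -> P u) ->
  forall u, P u.
Proof.
move=> PD Phom u.
have [s [s_hom ->]] : exists s : seq E,
    (forall v, v \in s -> exists n, ext_deg n v) /\ u = \sum_(v <- s) v.
  elim/ext_ind: u => [a|x|_ _ [s [hs ->]] [t [ht ->]]|_ _ [s [hs ->]] [t [ht ->]]].
  - exists [:: a%:A]; rewrite big_seq1; split=> // v; rewrite inE => /eqP ->.
    by exists 0; apply: ext_deg_sc.
  - exists [:: \i x]; rewrite big_seq1; split=> // v; rewrite inE => /eqP ->.
    by exists 1; apply: ext_deg_in.
  - exists (s ++ t); rewrite big_cat; split=> // w.
    by rewrite mem_cat => /orP[/hs|/ht].
  - exists [seq v * w | v <- s, w <- t]; split.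
      move=> _ /allpairsP[[v w] /= [/hs[m dv] /ht[n dw] ->]].
      by exists (m + n)%N; apply: ext_degM.
    by rewrite big_distrlr /= big_allpairs_dep.
elim: s s_hom => [|v s IH] hs.
  by rewrite big_nil; apply: (Phom 0); apply: ext_deg0.
rewrite big_cons; apply: PD.
  by have [|n dv] := hs v; [rewrite inE eqxx | apply: Phom dv].
by apply: IH => w ws; apply: hs; rewrite inE ws orbT.
Qed.

(** The extension of [x |-> - x] by the universal property is multiplicative and [A]-linear by
    construction; [ext_sign_deg] recovers the usual sign. *)
Definition ext_sign : {lrmorphism E -> E} :=
  projT1 (cid (@ext_universal A L E (\- ext_in (A:=A) (L:=L))
    (fun x => etrans (mulrNN _ _) (ext_in_sq x)))).

Lemma ext_sign_in x : ext_sign (\i x) = - \i x.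
Proof. by rewrite /ext_sign; case: cid => g /= ->. Qed.

Lemma ext_sign_deg n u : ext_deg n u -> ext_sign u = (-1) ^+ n * u.
Proof.
move: n u; apply: ext_deg_ind => [n|n u v hu hv|n a u _ hu||n x u _ hu].
- by rewrite raddf0 mulr0.
- by rewrite raddfD /= hu hv mulrDr.
- by rewrite linearZ /= hu scalerAr.
- by rewrite rmorph1 mul1r.
- by rewrite rmorphM /= ext_sign_in hu exprS mulN1r !mulNr !mulrA commr_sign.
Qed.

Lemma ext_sign_sc a : ext_sign a%:A = a%:A.
Proof. by rewrite linearZ /= rmorph1. Qed.

End ExteriorDegree.

(** * Consequences of the Gerstenhaber axioms *)

Section ExteriorBracket.
Variables (k : fieldType) (A : comAlgType k) (L : lmodType A).
Variables (R : lieRinehart L) (br : extalg L -> extalg L -> extalg L).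
Hypothesis br_ext : is_ext_gerstenhaber_bracket R br.
Local Notation E := (extalg L).
Local Notation "\i x" := (@ext_in A L x) (at level 10, x at level 9).
Local Notation pdeg := (deg_pred (@ext_deg A L)).
Local Notation eps := (@ext_sign A L).
Implicit Types (u v w : E) (x y : L) (a b : A).

Lemma deg_predD n u v :
  pdeg n u -> pdeg n v -> pdeg n (u + v).
Proof. by case: n => [-> ->|n]; [rewrite /= addr0 | apply: ext_degD]. Qed.

Lemma deg_predZ n a u : pdeg n u -> pdeg n (a *: u).
Proof. by case: n => [->|n]; [rewrite /= scaler0 | apply: ext_degZ]. Qed.

Lemma deg_predMl m n u v :
  ext_deg m u -> pdeg n v -> pdeg (m + n) (u * v).
Proof.
case: n => [du ->|n du dv]; last by rewrite addnS; apply: ext_degM.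
by rewrite mulr0; case: (_ + _)%N => //= i; apply: ext_deg0.
Qed.

(** Here [v] has degree n - 1, which has the parity of [n.+1]; for n = 0 both sides vanish. *)
Lemma deg_pred_comm m n u v : ext_deg m u -> pdeg n v ->
  v * u = (-1) ^+ (n.+1 * m) * (u * v).
Proof.
case: n => [_ ->|n du dv]; first by rewrite mul0r !mulr0.
by rewrite (ext_deg_comm dv du) !signE !oddM /= negbK.
Qed.

Lemma brDl u v w : br (u + v) w = br u w + br v w.
Proof. by have [[+ _ _ _ _ _] _ _] := br_ext => /(_ w 1 u v); rewrite !scale1r. Qed.

Lemma brDr u v w : br u (v + w) = br u v + br u w.
Proof. by have [[_ + _ _ _ _] _ _] := br_ext => /(_ u 1 v w); rewrite !scale1r. Qed.

Lemma br0l u : br 0 u = 0.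
Proof.
have /eqP := brDl 0 0 u.
by rewrite addr0 -subr_eq0 opprD addNKr oppr_eq0 => /eqP.
Qed.

Lemma br0r u : br u 0 = 0.
Proof.
have /eqP := brDr u 0 0.
by rewrite addr0 -subr_eq0 opprD addNKr oppr_eq0 => /eqP.
Qed.

Lemma brNl u v : br (- u) v = - br u v.
Proof. by apply/eqP; rewrite -addr_eq0 -brDl addNr br0l. Qed.

Lemma brNr u v : br u (- v) = - br u v.
Proof. by apply/eqP; rewrite -addr_eq0 -brDr addNr br0r. Qed.

Lemma br_signl n u v : br ((-1) ^+ n * u) v = (-1) ^+ n * br u v.
Proof. by rewrite -signr_odd; case: odd; rewrite !(mul1r, mulN1r) ?brNl. Qed.

Lemma br_signr n u v : br u ((-1) ^+ n * v) = (-1) ^+ n * br u v.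
Proof. by rewrite -signr_odd; case: odd; rewrite !(mul1r, mulN1r) ?brNr. Qed.

Lemma br_deg m n u v : ext_deg m u -> ext_deg n v -> pdeg (m + n) (br u v).
Proof. by have [[_ _ + _ _ _] _ _] := br_ext; apply. Qed.

Lemma br_antisym m n u v : ext_deg m u -> ext_deg n v ->
  br u v = (-1) ^+ (m * n + m + n) * br v u.
Proof.
have [[_ _ _ h _ _] _ _] := br_ext => du dv; rewrite (h _ _ _ _ du dv).
by rewrite !signE !oddD !oddM /=; case: (odd m); case: (odd n);
  rewrite /= !(mul1r, mulN1r, opprK).
Qed.

(** Stating the rule for [u] of degree l - 1 lets it apply to [D u] as well, including the case
    where [D u] lies in degree -1. *)
Lemma br_leibniz l m n u v w : pdeg l u -> ext_deg m v -> ext_deg n w ->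
  br u (v * w) = br u v * w + (-1) ^+ (l * m) * v * br u w.
Proof.
have [[_ _ _ _ _ h] _ _] := br_ext; case: l => [->|l]; last exact: h.
by rewrite !br0l mul0r mulr0 addr0.
Qed.

(** Antisymmetry reduces this to the rule in the second argument; [v] is then moved past [br u w],
    of degree l + n - 1. *)
Lemma br_leibnizl l m n u v w : ext_deg l u -> ext_deg m v -> ext_deg n w ->
  br (u * v) w = u * br v w + (-1) ^+ (l * m) * v * br u w.
Proof.
move=> du dv dw; rewrite (br_antisym (ext_degM du dv) dw).
rewrite (@br_leibniz n.+1 l m w u v) // (br_antisym dw du) (br_antisym dw dv).
have := deg_pred_comm dv (br_deg du dw).
signs; case: (odd l); case: (odd m); case: (odd n); expand => ->; expand; cancel.
Qed.

(** The bracket lies in degree -1, where [deg_pred] leaves only 0. *)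
Lemma br_sc_sc a b : br a%:A b%:A = 0.
Proof. exact: br_deg (ext_deg_sc L a) (ext_deg_sc L b). Qed.

Lemma br_in_sc x a : br (\i x) a%:A = (anchor R x a)%:A.
Proof. by have [_ _ ->] := br_ext. Qed.

Lemma br_in_in x y : br (\i x) (\i y) = \i (lieb R x y).
Proof. by have [_ -> _] := br_ext. Qed.

Lemma br_sc_in a x : br a%:A (\i x) = - (anchor R x a)%:A.
Proof.
by rewrite (br_antisym (ext_deg_sc L a) (ext_deg_in x)) mulN1r br_in_sc.
Qed.

(** The Leibniz rule for 1 * 1 gives [u, 1] = [u, 1] + [u, 1]. *)
Lemma br_u1 u : br u 1 = 0.
Proof.
elim/ext_hom_ind: u => [u v hu hv|n u du]; first by rewrite brDl hu hv addr0.
have /eqP := @br_leibniz n.+1 0 0 u 1 1 du (ext_deg1 L) (ext_deg1 L).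
by rewrite muln0 !mulr1 mul1r eq_sym -subr_eq0 addrK => /eqP.
Qed.

Lemma br_1u u : br 1 u = 0.
Proof.
elim/ext_hom_ind: u => [u v hu hv|n u du]; first by rewrite brDr hu hv addr0.
by rewrite (br_antisym (ext_deg1 L) du) br_u1 mulr0.
Qed.

(** This makes (a, 0) central for [bv_mul]. *)
Lemma br_sc_comm a u : br a%:A u = br (eps u) a%:A.
Proof.
elim/ext_hom_ind: u => [u v hu hv|n u du].
  by rewrite raddfD /= brDl brDr hu hv.
rewrite (br_antisym (ext_deg_sc L a) du) (ext_sign_deg du) br_signl.
by rewrite mul0n add0n.
Qed.

(** This is the Hochschild 2-cocycle condition for (u, v) |-> [eps u, v], the left action being
    twisted by [eps]; associativity of [bv_mul] rests on it. On homogeneous elements it follows from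
    the two Leibniz rules. *)
Lemma br_cocycle u v w :
  br (eps (u * v)) w + br (eps u) v * w = br (eps u) (v * w) + eps u * br (eps v) w.
Proof.
elim/ext_hom_ind: u => [u u' hu hu'|l u du].
  rewrite mulrDl !raddfD /= !(brDl, mulrDl) addrACA hu hu' addrACA.
  by rewrite -brDl.
elim/ext_hom_ind: v => [v v' hv hv'|m v dv].
  rewrite mulrDr mulrDl !raddfD /= !(brDl, brDr, mulrDl, mulrDr).
  by rewrite addrACA hv hv' addrACA.
elim/ext_hom_ind: w => [w w' hw hw'|n w dw].
  rewrite mulrDr !(brDr, mulrDr).
  by rewrite addrACA hw hw' addrACA.
rewrite (ext_sign_deg (ext_degM du dv)) (ext_sign_deg du) (ext_sign_deg dv).
rewrite !br_signl (br_leibnizl du dv dw) (@br_leibniz l.+1 m n u v w) //.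
signs; case: (odd l); case: (odd m); expand; cancel.
Qed.

(** * The square-zero extension of the exterior algebra by the bracket cocycle *)

(* The unused argument lets the instances below, whose axioms depend on the
   bracket identities, be inferred from the type. *)
Definition bv_ext (_ : is_ext_gerstenhaber_bracket R br) : Type := (E * E)%type.
Local Notation B := (bv_ext br_ext).

HB.instance Definition _ := GRing.Zmodule.on B.

Definition bv_mul (p q : B) : B :=
  (p.1 * q.1, br (eps p.1) q.1 + p.2 * q.1 + eps p.1 * q.2).

Definition bv_one : B := (1, 0).

Fact bv_mulA : associative bv_mul.
Proof.
move=> [u u'] [v v'] [w w']; rewrite /bv_mul /=; congr pair; first exact: mulrA.
have := br_cocycle u v w; rewrite rmorphM /= => h.
by expand; rewrite h; cancel.
Qed.

Fact bv_mul1l : left_id bv_one bv_mul.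
Proof.
move=> [u u']; rewrite /bv_mul /= rmorph1 !mul1r br_1u mul0r.
by rewrite !add0r.
Qed.

Fact bv_mul1r : right_id bv_one bv_mul.
Proof. by move=> [u u']; rewrite /bv_mul /= !mulr1 br_u1 mulr0 add0r addr0. Qed.

Fact bv_mulDl : left_distributive bv_mul +%R.
Proof.
move=> [u u'] [v v'] [w w']; rewrite /bv_mul /= raddfD /= brDl !mulrDl.
by congr pair; cancel.
Qed.

Fact bv_mulDr : right_distributive bv_mul +%R.
Proof.
move=> [u u'] [v v'] [w w']; rewrite /bv_mul /= brDr !mulrDr.
by congr pair; cancel.
Qed.

Fact bv_oner_neq0 : bv_one != 0.
Proof. by rewrite -pair_eqE negb_and oner_neq0. Qed.

HB.instance Definition _ := GRing.Zmodule_isNzRing.Build B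
  bv_mulA bv_mul1l bv_mul1r bv_mulDl bv_mulDr bv_oner_neq0.

Definition bv_sc a : B := (a%:A, 0).
(** With scaling defined as multiplication by a central element, the module and algebra axioms come
    from the ring axioms. *)
Definition bv_scale a (p : B) : B := bv_sc a * p.

Fact bv_scC a (p : B) : bv_sc a * p = p * bv_sc a.
Proof.
case: p => u u'; congr pair; first by rewrite /= mulr_algl mulr_algr.
by rewrite /= ext_sign_sc br_sc_comm mul0r mulr0 !addr0 mulr_algl mulr_algr.
Qed.

Fact bv_scD : {morph bv_sc : a b / a + b}.
Proof. by move=> a b; congr pair; rewrite /= ?scalerDl ?addr0. Qed.

Fact bv_scM : {morph bv_sc : a b / a * b}.
Proof.
move=> a b; congr pair; rewrite /= ?mulr_algl ?scalerA //.
by rewrite ext_sign_sc br_sc_sc mul0r mulr0 !addr0.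
Qed.

Fact bv_scaleA a b p : bv_scale a (bv_scale b p) = bv_scale (a * b) p.
Proof. by rewrite /bv_scale bv_scM mulrA. Qed.

Fact bv_scale1 : left_id 1 bv_scale.
Proof. by move=> p; rewrite /bv_scale /bv_sc scale1r mul1r. Qed.

Fact bv_scaleDr : right_distributive bv_scale +%R.
Proof. by move=> a p q; rewrite /bv_scale mulrDr. Qed.

Fact bv_scaleDl p : {morph bv_scale^~ p : a b / a + b}.
Proof. by move=> a b; rewrite /bv_scale bv_scD mulrDl. Qed.

HB.instance Definition _ := GRing.Zmodule_isLmodule.Build A B
  bv_scaleA bv_scale1 bv_scaleDr bv_scaleDl.

Fact bv_scaleAl a (p q : B) : a *: (p * q) = (a *: p) * q.
Proof. exact: mulrA. Qed.

HB.instance Definition _ := GRing.Lmodule_isLalgebra.Build A B bv_scaleAl.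

Fact bv_scaleAr a (p q : B) : a *: (p * q) = p * (a *: q).
Proof.
change (bv_sc a * (p * q) = p * (bv_sc a * q)).
by rewrite !mulrA bv_scC.
Qed.

HB.instance Definition _ := GRing.Lalgebra_isAlgebra.Build A B bv_scaleAr.

Lemma bv_scaleE a (p : B) :
  a *: p = (a *: p.1, br a%:A p.1 + a *: p.2) :> E * E.
Proof.
case: p => u u'; congr pair; first by rewrite /= mulr_algl.
by rewrite /= ext_sign_sc mul0r addr0 mulr_algl.
Qed.

Lemma bv_of_divergence (div : L -> A) :
    (forall x y, div (x + y) = div x + div y) ->
    (forall a x, div (a *: x) = a * div x + anchor R x a) ->
  exists D : E -> E,
    [/\ {morph D : u v / u + v}, forall a, D a%:A = 0,
        forall x, D (\i x) = - (div x)%:A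
      & forall u v, D (u * v) = br (eps u) v + D u * v + eps u * D v].
Proof.
move=> divD divZ; pose f x : B := (\i x, - (div x)%:A).
have fL : linear f.
  move=> a x y; rewrite /f bv_scaleE; congr pair; first exact: linearP.
  by rewrite /= br_sc_in divD divZ !scalerDl -scalerA scalerN; cancel.
(* In the second component [X, X] vanishes and the two terms with [div x] cancel because [eps]
   negates [X]. *)
have f2 x : f x * f x = 0.
  congr pair; first exact: ext_in_sq.
  rewrite /= ext_sign_in brNl br_in_in liebxx linear0 oppr0 add0r mulrNN.
  by rewrite mulNr mulr_algl mulr_algr addNr.
pose mf := GRing.isLinear.Build A L B *:%R f fL.
pose F : {linear L -> B} := HB.pack f mf.
have [G [GD Gsc Gin GM]] : exists G : E -> B,
    [/\ {morph G : u v / u + v}, forall a, G a%:A = bv_sc a,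
        forall x, G (\i x) = f x & {morph G : u v / u * v}].
  have [g gE] := @ext_universal A L B F f2; exists g; split.
  - exact: raddfD.
  - by move=> a; rewrite linearZ rmorph1; exact: (mulr1 (bv_sc a)).
  - exact: gE.
  - exact: rmorphM.
(* [G] is a section of the first projection, so its multiplicativity, read in the second component,
   is the product rule for [D]. *)
have G1 u : (G u).1 = u.
  elim/ext_ind: u => [a|x|u v hu hv|u v hu hv].
  - by rewrite Gsc.
  - by rewrite Gin.
  - by rewrite GD /= hu hv.
  - by rewrite GM /= hu hv.
exists (fun u => (G u).2); split=> [u v|a|x|u v].
- by rewrite GD.
- by rewrite Gsc.
- by rewrite Gin.
- by rewrite GM /= !G1.
Qed.

End ExteriorBracket.

(** * From a divergence operator to a BV generator *)

Section BVFromDivergence.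
Variables (k : fieldType) (A : comAlgType k) (L : lmodType A).
Variables (R : lieRinehart L) (br : extalg L -> extalg L -> extalg L).
Hypothesis br_ext : is_ext_gerstenhaber_bracket R br.
Variables (div : L -> A) (D : extalg L -> extalg L).
Hypothesis div_lieb : forall X Y,
  div (lieb R X Y) = anchor R X (div Y) - anchor R Y (div X).
Hypothesis D_add : {morph D : u v / u + v}.
Hypothesis D_sc : forall a, D a%:A = 0.
Hypothesis D_in : forall x, D (ext_in x) = - (div x)%:A.
Hypothesis D_mul :
  forall u v, D (u * v) = br (ext_sign L u) v + D u * v + ext_sign L u * D v.

Local Notation E := (extalg L).
Local Notation "\i x" := (@ext_in A L x) (at level 10, x at level 9).
Local Notation pdeg := (deg_pred (@ext_deg A L)).
Local Notation eps := (@ext_sign A L).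
Implicit Types (u v w : E) (x y : L) (a b : A).

Lemma D0 : D 0 = 0.
Proof. by have := D_sc 0; rewrite scale0r. Qed.

Lemma D1 : D 1 = 0.
Proof. by have := D_sc 1; rewrite scale1r. Qed.

Lemma DN u : D (- u) = - D u.
Proof. by apply/eqP; rewrite -addr_eq0 -D_add addNr D0. Qed.

Lemma D_sign n u : D ((-1) ^+ n * u) = (-1) ^+ n * D u.
Proof. by rewrite -signr_odd; case: odd; rewrite !(mul1r, mulN1r) ?DN. Qed.

Lemma DZ a u : D (a *: u) = br a%:A u + a *: D u.
Proof. by rewrite -(mulr_algl a u) D_mul ext_sign_sc D_sc mul0r addr0 mulr_algl. Qed.

(** The correction term in [DZ] vanishes for constants from [k]: it is a multiple of [br 1 u]. *)
Lemma D_klinear : @klinear k A E D.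
Proof.
move=> c u v; rewrite D_add DZ; congr (_ + _).
have [[h _ _ _ _ _] _ _] := br_ext.
have := h u c 1 0; rewrite !addr0 => ->.
by rewrite (br_1u br_ext) (br0l br_ext) scaler0 !add0r.
Qed.

Lemma D_deg n u : ext_deg n u -> pdeg n (D u).
Proof.
move: n u; apply: ext_deg_ind => [n|n u v hu hv|n a u du hu||n x u du hu].
- by rewrite D0; case: n => //= n; apply: ext_deg0.
- by rewrite D_add; apply: deg_predD.
- rewrite DZ; apply: deg_predD; last exact: deg_predZ.
  exact: (br_deg br_ext (ext_deg_sc L a) du).
- exact: D1.
- rewrite D_mul ext_sign_in D_in (brNl br_ext) !mulNr.
  apply: deg_predD; first apply: deg_predD.
  + by rewrite -scaleN1r; exact: (deg_predZ _ (br_deg br_ext (ext_deg_in x) du)).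
  + by rewrite -scaleN1r mulr_algl; do 2!apply: deg_predZ.
  + by rewrite -scaleN1r; exact: (deg_predZ _ (deg_predMl (ext_deg_in x) hu)).
Qed.

Lemma D_generates : generates (@ext_deg A L) D br.
Proof.
move=> m n u v du dv; rewrite D_mul D1 (ext_sign_deg du) (br_signl br_ext).
by rewrite !mulrDr !mulrA -exprD addnn signE odd_double /=; expand; cancel.
Qed.

Lemma D_mul_hom l u v : ext_deg l u ->
  D (u * v) = (-1) ^+ l * br u v + D u * v + (-1) ^+ l * u * D v.
Proof. by move=> du; rewrite D_mul (ext_sign_deg du) (br_signl br_ext). Qed.

(** Once [D] of each product other than [u * v] is expanded, the bracket terms cancel by
    [br_leibnizl]. *)
Lemma D_seven_term l m n u v w : ext_deg l u -> ext_deg m v -> ext_deg n w ->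
  D (u * v * w) - D (u * v) * w + D u * v * w
  - (-1) ^+ l * u * D (v * w) - (-1) ^+ (l.+1 * m) * v * D (u * w)
  + (-1) ^+ l * u * D v * w + (-1) ^+ (l + m) * u * v * D w
  - D 1 * u * v * w = 0.
Proof.
move=> du dv dw; rewrite D1 (D_mul_hom w (ext_degM du dv)).
rewrite (D_mul_hom w dv) (D_mul_hom w du) (br_leibnizl br_ext du dv dw).
(* The remaining terms cancel after [v] is moved past [D u] and past [u]. *)
have := deg_pred_comm dv (D_deg du); have := ext_deg_comm du dv.
move=> h1 h2.
have h3 : D u * v * w = (-1) ^+ (l.+1 * m) * (v * D u) * w by rewrite h2.
have {h1} h1 : u * v * D w = (-1) ^+ (l * m) * (v * u) * D w by rewrite h1.
move: h1 h3.
signs; case: (odd l); case: (odd m); expand => -> ->; expand; cancel.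
Qed.

Lemma br_D_leibniz l m n u v w : ext_deg l u -> ext_deg m v -> ext_deg n w ->
  br u (D v * w) = br u (D v) * w + (-1) ^+ (l.+1 * m.+1) * D v * br u w.
Proof.
move=> du dv dw; have := D_deg dv; case: m dv => [_ ->|m dv dDv].
  by rewrite (mulr0, mul0r) !(br0r br_ext, mulr0, mul0r) addr0.
rewrite (@br_leibniz _ _ _ _ _ br_ext l.+1 m n) //.
by signs; rewrite negbK.
Qed.

Lemma br_leibniz_D l m n u v w : ext_deg l u -> ext_deg m v -> ext_deg n w ->
  br u (v * D w) = br u v * D w + (-1) ^+ (l.+1 * m) * v * br u (D w).
Proof.
move=> du dv /D_deg; case: n => [->|n dDw].
  by rewrite mulr0 (br0r br_ext) !mulr0 addr0.
exact: (@br_leibniz _ _ _ _ _ br_ext l.+1 m n).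
Qed.

(** The degree of [u] is l - 1, hence the reversed signs; this form applies to [br u v] and
    [D u]. *)
Lemma D_mul_pdeg l u v : pdeg l u ->
  D (u * v) = - ((-1) ^+ l * br u v) + D u * v - (-1) ^+ l * u * D v.
Proof.
case: l => [->|l du].
  by rewrite mul0r D0 (br0l br_ext) !(mulr0, mul0r) oppr0 !addr0.
by rewrite (D_mul_hom _ du) exprS !mulN1r !mulNr !opprK.
Qed.

Definition defect u v := D (br u v) - br (D u) v + br (eps u) (D v).

(** The operator [defect u] has degree l - 2, hence the sign. After expansion the mixed terms cancel
    in pairs, leaving three iterated brackets that the Jacobi identity removes. *)
Lemma defect_leibniz l m n u v w :
  ext_deg l u -> ext_deg m v -> ext_deg n w ->
  defect u (v * w) = defect u v * w + (-1) ^+ (l * m) * v * defect u w.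
Proof.
move=> du dv dw; rewrite /defect (ext_sign_deg du) !(br_signl br_ext).
rewrite (@br_leibniz _ _ _ _ _ br_ext l.+1 m n) // D_add -mulrA D_sign.
rewrite (D_mul_pdeg _ (br_deg br_ext du dv)) (D_mul_hom _ dv).
rewrite (br_leibniz br_ext (D_deg du) dv dw) (D_mul_hom _ dv).
rewrite -[_ * v * D w]mulrA !(brDr br_ext) !(br_signr br_ext).
rewrite (br_D_leibniz du dv dw) (br_leibniz_D du dv dw).
have [[_ _ _ _ jac _] _ _] := br_ext.
rewrite (jac _ _ _ _ _ _ du dv dw).
by signs; case: (odd l); case: (odd m); expand; cancel.
Qed.

(** The square has even degree -2, so no sign accompanies [u * D (D v)]; the terms [D u * D v]
    cancel. *)
Lemma D_sq_mul l u v : ext_deg l u ->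
  D (D (u * v)) = D (D u) * v + u * D (D v) + (-1) ^+ l * defect u v.
Proof.
move=> du; rewrite /defect (ext_sign_deg du) !(br_signl br_ext).
rewrite (D_mul_hom _ du) !D_add -mulrA !D_sign (D_mul_pdeg _ (D_deg du)).
rewrite (D_mul_hom _ du).
by signs; case: (odd l); expand; cancel.
Qed.

Lemma defectDr u v w : defect u (v + w) = defect u v + defect u w.
Proof. by rewrite /defect !(D_add, brDr br_ext); cancel. Qed.

Lemma defect0r u : defect u 0 = 0.
Proof. by rewrite /defect D0 !(br0r br_ext) D0 subr0 addr0. Qed.

Lemma defect_eq0 l u : ext_deg l u ->
    (forall a, defect u a%:A = 0) -> (forall x, defect u (\i x) = 0) ->
  forall v, defect u v = 0.
Proof.
move=> du usc uin; elim/ext_hom_ind => [v w hv hw|n v dv].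
  by rewrite defectDr hv hw addr0.
move: n v dv; apply: ext_deg_ind => [n|n v w hv hw|n a v dv hv||n x v dv hv].
- exact: defect0r.
- by rewrite defectDr hv hw addr0.
- rewrite -(mulr_algl a v) (defect_leibniz du (ext_deg_sc L a) dv).
  by rewrite usc hv mul0r mulr0 addr0.
- by have := usc 1; rewrite scale1r.
- rewrite (defect_leibniz du (ext_deg_in x) dv).
  by rewrite uin hv mul0r mulr0 addr0.
Qed.

Lemma defect_sc a v : defect a%:A v = 0.
Proof.
apply: defect_eq0 v; first exact: ext_deg_sc.
- move=> b; rewrite /defect !D_sc (br_sc_sc br_ext) D0.
  by rewrite (br0l br_ext) (br0r br_ext) subr0 addr0.
- move=> x; rewrite /defect D_sc (br0l br_ext) (br_sc_in br_ext) DN D_sc D_in.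
  by rewrite ext_sign_sc (brNr br_ext) (br_sc_sc br_ext) !oppr0 !addr0.
Qed.

Lemma defect_in x v : defect (\i x) v = 0.
Proof.
apply: defect_eq0 v; first exact: ext_deg_in.
- move=> a; rewrite /defect !D_sc (br_in_sc br_ext) D_sc D_in (brNl br_ext).
  by rewrite (br_sc_sc br_ext) (br0r br_ext) !oppr0 !addr0.
(* The defect of two generators is X(div Y) - Y(div X) - div[X, Y]. *)
- move=> y; rewrite /defect (br_in_in br_ext) !D_in div_lieb ext_sign_in.
  rewrite !(brNl br_ext) !(brNr br_ext) (br_sc_in br_ext) (br_in_sc br_ext).
  by rewrite scalerBl; expand; cancel.
Qed.

Lemma D_sq u : D (D u) = 0.
Proof.
elim/ext_hom_ind: u => [u v hu hv|n u du]; first by rewrite !D_add hu hv addr0.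
move: n u du; apply: ext_deg_ind => [n|n u v hu hv|n a u _ hu||n x u _ hu].
- by rewrite !D0.
- by rewrite !D_add hu hv addr0.
- rewrite -(mulr_algl a u) (D_sq_mul _ (ext_deg_sc L a)) defect_sc hu.
  by rewrite D_sc D0 mul0r !mulr0 !addr0.
- by rewrite D1 D0.
- rewrite (D_sq_mul _ (ext_deg_in x)) defect_in hu D_in DN D_sc.
  by rewrite oppr0 mul0r !mulr0 !addr0.
Qed.

Lemma D_BV_operator : BV_operator (@ext_deg A L) D.
Proof.
split; [exact: D_klinear | exact: D_deg | exact: D_sq | exact: D_seven_term].
Qed.

End BVFromDivergence.

(** * From a BV generator to its divergence, and uniqueness of the generator *)

Section Uniqueness.
Variables (k : fieldType) (A : comAlgType k) (L : lmodType A).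
Variables (R : lieRinehart L) (br : extalg L -> extalg L -> extalg L).
Hypothesis br_ext : is_ext_gerstenhaber_bracket R br.
Local Notation E := (extalg L).
Local Notation "\i x" := (@ext_in A L x) (at level 10, x at level 9).
Local Notation BV D :=
  (BV_operator (@ext_deg A L) D /\ generates (@ext_deg A L) D br).

Lemma BV_add D : BV_operator (@ext_deg A L) D -> {morph D : u v / u + v}.
Proof. by move=> [Dlin _ _ _] u v; have := Dlin 1 u v; rewrite !scale1r. Qed.

Lemma BV_sc D a : BV_operator (@ext_deg A L) D -> D a%:A = 0.
Proof. by move=> [_ Ddeg _ _]; apply: (Ddeg 0); apply: ext_deg_sc. Qed.

Lemma BV_mul D m n u v : BV D -> ext_deg m u -> ext_deg n v ->
  D (u * v) = (-1) ^+ m * br u v + D u * v + (-1) ^+ m * u * D v.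
Proof.
move=> [BVD Dgen] du dv; rewrite (Dgen _ _ _ _ du dv).
have := BV_sc 1 BVD; rewrite scale1r => ->.
by signs; case: (odd m); expand; cancel.
Qed.

(** The bracket fixes the product rule [BV_mul], and both operators kill scalars, so values on
    generators determine everything. *)
Lemma BV_uniq D D' : BV D -> BV D' ->
  (forall x, D (\i x) = D' (\i x)) -> forall u, D u = D' u.
Proof.
move=> BVD BVD' DD'; elim/ext_hom_ind => [u v hu hv|n u du].
  by rewrite (BV_add BVD.1) (BV_add BVD'.1) hu hv.
have D0' B : BV B -> B 0 = 0 by move=> [/(BV_sc 0)]; rewrite scale0r.
move: n u du; apply: ext_deg_ind => [n|n u v hu hv|n a u du hu||n x u du hu].
- by rewrite !D0'.
- by rewrite (BV_add BVD.1) (BV_add BVD'.1) hu hv.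
- rewrite -(mulr_algl a u) (BV_mul BVD (ext_deg_sc L a) du).
  rewrite (BV_mul BVD' (ext_deg_sc L a) du) hu.
  by rewrite (BV_sc a BVD.1) (BV_sc a BVD'.1).
- have := BV_sc 1 BVD.1; have := BV_sc 1 BVD'.1.
  by rewrite scale1r => -> ->.
- by rewrite (BV_mul BVD (ext_deg_in x) du) (BV_mul BVD' (ext_deg_in x) du) hu DD'.
Qed.

Lemma BV_in D : BV_operator (@ext_deg A L) D ->
  exists div : L -> A, forall x, D (\i x) = - (div x)%:A.
Proof.
move=> [_ Ddeg _ _].
have ex x : exists a, D (\i x) = - a%:A.
  have [a Da] := ext_deg0E (Ddeg 1 _ (ext_deg_in x)).
  (* The sign comes from [a, X] = - X(a): with div = - D on [L], the rule for [a *: X] acquires +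
     X(a). *)
  by exists (- a); rewrite Da scaleNr opprK.
by exists (fun x => projT1 (cid (ex x))) => x; case: cid.
Qed.

Lemma divergence_of_BV D (div : L -> A) : BV D ->
    (forall x, D (\i x) = - (div x)%:A) ->
  [/\ forall x y, div (x + y) = div x + div y,
      forall x y, div (lieb R x y) = anchor R x (div y) - anchor R y (div x)
    & forall a x, div (a *: x) = a * div x + anchor R x a].
Proof.
move=> BVD Din; have [Dop _] := BVD; have Dadd := BV_add Dop.
have DN u : D (- u) = - D u.
  apply/eqP; rewrite -addr_eq0 -Dadd addNr.
  by have := BV_sc 0 Dop; rewrite scale0r => ->.
have Dsc_in a x : D (a *: \i x) = - (anchor R x a)%:A - (a * div x)%:A.
  rewrite -(mulr_algl a (\i x)) (BV_mul BVD (ext_deg_sc L a) (ext_deg_in x)) Din.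
  rewrite (BV_sc a Dop) (br_sc_in br_ext) mul0r addr0 !mul1r mulrN.
  by rewrite mulr_algl scalerA.
(* Each identity in [A] is checked in the exterior algebra as an identity between values of [D]. *)
have neg_inj : injective (fun a => - (a%:A) : E).
  by move=> a b /oppr_inj/ext_sc_inj.
split=> [x y|x y|a x]; apply: neg_inj; rewrite -Din.
- by rewrite raddfD Dadd !Din scalerDl opprD.
- have := BV_mul BVD (ext_deg_in x) (ext_deg_in y).
  rewrite (br_in_in br_ext) !Din mulN1r !mulNr mul1r mulrN opprK.
  rewrite mulr_algl mulr_algr => /(congr1 D).
  rewrite (BV_sq Dop) !Dadd !DN !Dsc_in => /esym/eqP.
  rewrite -addrA addr_eq0 eqr_opp -Din => /eqP ->.
  (* Applying [D] to [div y *: X] and [div x *: Y] produces the product of the two divergences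
     twice; the copies cancel by commutativity of [A]. *)
  by rewrite scalerBl (mulrC (div y)); expand; cancel.
- by rewrite linearZ Dsc_in scalerDl addrC opprD.
Qed.

End Uniqueness.

(** The final clause says which bijection is meant; since [a |-> a%:A] is injective, it determines
    [Phi]. *)
Theorem proposition1p8 (k : fieldType) (A : comAlgType k) (L : lmodType A)
    (R : lieRinehart L) (br : extalg L -> extalg L -> extalg L)
    (br_ext : is_ext_gerstenhaber_bracket R br) :
  exists Phi : BV_generator br -> divergence_operator R,
    bijective Phi /\
    forall (D : BV_generator br) (X : L),
      sval D (ext_in X) = - (sval (Phi D) X)%:A.
Proof.
(* Each direction is chosen together with its relation D(X) = - div X, the only fact about the
   choice used below. *)
have to_div (D : BV_generator br) : {d : divergence_operator R |
    forall x, sval D (ext_in x) = - (sval d x)%:A}.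
  apply: cid; case: D => D BVD /=; have [div Din] := BV_in BVD.1.
  by exists (exist _ div (divergence_of_BV br_ext BVD Din)).
have to_BV (d : divergence_operator R) : {D : BV_generator br |
    forall x, sval D (ext_in x) = - (sval d x)%:A}.
  apply: cid; case: d => div [divD div_lieb divZ] /=.
  have [D [DD Dsc Din Dmul]] := bv_of_divergence br_ext divD divZ.
  have BVD := D_BV_operator br_ext div_lieb DD Dsc Din Dmul.
  by exists (exist _ D (conj BVD (D_generates br_ext Dsc Dmul))).
exists (fun D => sval (to_div D)); split=> [|D]; last exact: svalP (to_div D).
(* One composite is the identity by [BV_uniq], the other by injectivity of the structure map;
   [eq_exist] reduces both to the underlying functions. *)
exists (fun d => sval (to_BV d)) => [D|d].
  have := svalP (to_div D); move: (sval (to_div D)) => d hD.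
  have := svalP (to_BV d); move: (sval (to_BV d)) => D' hD'.
  case: D D' hD hD' => D BVD [D' BVD'] /= hD hD'.
  apply: eq_exist; apply/funext; apply: BV_uniq BVD' BVD _ => x.
  by rewrite hD hD'.
have := svalP (to_div (sval (to_BV d))); have := svalP (to_BV d).
move: (sval (to_div _)) => d' hd hd'.
case: d d' hd hd' => div Hdiv [div' Hdiv'] /= hd hd'.
apply: eq_exist; apply/funext => x; apply: (@ext_sc_inj _ L).
by apply: oppr_inj; rewrite -hd -hd'.
Qed.
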